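(* Let $a,b,c\ge 0$ be integers with $a+c\ge 1$, $b+c\ge 1$, and $a+b+c\le D$. Let $I_a,I_b,I_c\subseteq\{1,\dots,D\}$ be pairwise disjoint with $|I_a|=a$, $|I_b|=b$, $|I_c|=c$. Define $u,v\in\mathbb{R}^D$ by $u_i=\frac{1}{a+c}$ for $i\in I_a\cup I_c$ and $u_i=0$ otherwise, and $v_i=\frac{1}{b+c}$ for $i\in I_b\cup I_c$ and $v_i=0$ otherwise. Let $r_1,\dots,r_D$ be i.i.d. standard Cauchy random variables (density $\frac{1}{\pi(1+r^2)}$), and $x=\sum_i u_ir_i$, $y=\sum_i v_ir_i$. Then $$\Pr\big(\mathrm{sign}(x)\neq\mathrm{sign}(y)\big)=\frac{1}{2}-\frac{2}{\pi^2}E\left\{\tan^{-1}\!\left(\frac{c}{a}|R|\right)\tan^{-1}\!\left(\frac{c}{b}|R|\right)\right\},$$ where $R$ is a standard Cauchy random variable, with the convention that $\tan^{-1}\!\left(\frac{c}{0}|R|\right)=\frac{\pi}{2}$ when $c>0$ (note $R\neq0$ a.s.).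
   Context: $\tan^{-1}$ is the principal arctangent. In this setting $\rho_{\chi^2}=\sum_i\frac{2u_iv_i}{u_i+v_i}=\frac{2c}{a+b+2c}$. *)

(* Defs.v *)
From HB Require Import structures.
From mathcomp Require Import all_boot all_order all_algebra.
From mathcomp Require Import all_classical all_reals all_analysis.
Set Implicit Arguments. Unset Strict Implicit. Unset Printing Implicit Defensive.
Import Order.TTheory GRing.Theory Num.Theory.
Import numFieldNormedType.Exports.
Local Open Scope classical_set_scope.
Local Open Scope ring_scope.

Definition cauchy_pdf (R : realType) (x : R) : R := (pi * (1 + x ^+ 2))^-1.

Definition standard_cauchy d (T : measurableType d) (R : realType)
  (P : probability T R) (X : {RV P >-> R}) : Prop :=
  forall A : set R, measurable A ->
    P (X @^-1` A) = (\int[lebesgue_measure]_(x in A) (cauchy_pdf x)%:E)%E.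

Definition mutually_independent d (T : measurableType d) (R : realType)
  (P : probability T R) (n : nat) (X : 'I_n -> {RV P >-> R}) : Prop :=
  forall A : 'I_n -> set R, (forall i, measurable (A i)) ->
    P (\bigcap_(i in [set: 'I_n]) (X i @^-1` A i)) =
    (\prod_(i < n) P (X i @^-1` A i))%E.

Definition cauchy_expect (R : realType) (g : R -> R) : \bar R :=
  (\int[lebesgue_measure]_x (g x * cauchy_pdf x)%:E)%E.

Definition atan_ratio (R : realType) (c a : nat) (t : R) : R :=
  if a == 0%N then pi / 2 else atan (c%:R / a%:R * t).

Definition uvec (R : realType) (D : nat) (Ia Ic : {set 'I_D}) (a c : nat)
  (i : 'I_D) : R := if i \in Ia :|: Ic then (a + c)%:R^-1 else 0.

(* Main.v *)
(* Given the value t of the sum over Ic, the events x > 0 and y > 0 are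
   independent, with probabilities 1/2 + atan(t/a)/pi and 1/2 + atan(t/b)/pi;
   so they differ with probability 1/2 - 2 atan(t/a) atan(t/b) / pi^2, and t is
   distributed as c times a standard Cauchy variable.  That n independent
   standard Cauchy variables add up to n times one of them follows by induction
   from the convolution identity cauchy_pdf_convolution, a partial fraction
   computation valid off the null set z = 0. *)
Require Import Defs.
From HB Require Import structures.
From mathcomp Require Import all_boot all_order all_algebra.
From mathcomp Require Import all_classical all_reals all_analysis.
From mathcomp Require Import measurable_realfun ring lra.
Import Order.TTheory GRing.Theory Num.Theory.
Import numFieldNormedType.Exports.
Set Implicit Arguments. Unset Strict Implicit. Unset Printing Implicit Defensive.

Local Open Scope ring_scope.

(** * Improper integrals over the real line and the Cauchy kernel *)

Section real_line_integrals.
Context {R : realType}.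
Local Notation leb := (@lebesgue_measure R).
Local Open Scope classical_set_scope.

(** Independence is given as a product formula for events attached to single variables, whereas the
    argument needs the joint law of three sums over disjoint blocks. The predicate [chain] bridges
    this gap: two variables are merged into their sum by uniqueness of product measures, while all
    other variables are frozen inside an event E. Since a sum grows by one variable at a time, the
    convolution has to be computed for the unequal scales k and 1. A second obstacle is that
    [Num.sg] takes three values, while the conditional computation compares positivity only. The two
    events differ inside the set where x = 0 or y = 0, which is null because both sums have at least
    one term. *)

Lemma ge0_continuous_FTC2y_is_derive (f F : R -> R) (a l : R) :
  (forall x, 0 <= f x) -> continuous f ->
  (forall x : R, is_derive x 1 F (f x)) ->
  F x @[x --> +oo] --> l ->
  (\int[leb]_(x in `[a, +oo[) (f x)%:E = (l - F a)%:E)%E.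
Proof.
move=> f0 cf dF Fl; rewrite (@ge0_continuous_FTC2y _ f F a l)//.
- exact: continuous_subspaceT.
- apply: cvg_at_right_filter.
  exact/differentiable_continuous/derivable1_diffP/(@ex_derive _ _ _ _ _ _ _ (dF a)).
- by move=> x _; rewrite derive1E (@derive_val _ _ _ _ _ _ _ (dF x)).
Qed.

(** Splitting at 0 and reflecting the negative half-line, where [fun x => - F (- x)] is a primitive
    of [f \o -%R], leaves two integrals over the half-line from 0 to +oo. *)
Lemma ge0_continuous_FTC2T (f F : R -> R) (l l' : R) :
  (forall x, 0 <= f x) -> continuous f ->
  (forall x : R, is_derive x 1 F (f x)) ->
  F x @[x --> +oo] --> l -> F x @[x --> -oo] --> l' ->
  (\int[leb]_x (f x)%:E = (l - l')%:E)%E.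
Proof.
move=> f0 cf dF Fl Fl'.
have mf : measurable_fun [set: R] f by exact: continuous_measurable_fun.
rewrite -(setUv `[(0:R), +oo[%classic) ge0_integral_setU//=; last 4 first.
- exact: measurableC.
- by apply/measurable_EFinP; rewrite setUv.
- by move=> x _; rewrite lee_fin.
- exact/disj_setPCl.
rewrite setCitvr integral_itv_bndo_bndc; last exact/measurable_EFinP/measurable_funTS.
rewrite -{2}oppr0 ge0_integration_by_substitutionNy//; last exact: continuous_subspaceT.
rewrite (ge0_continuous_FTC2y_is_derive _ f0 cf dF Fl).
have dG (x : R) : is_derive x 1 (fun x => - F (- x)) ((f \o -%R) x).
  have dFN : is_derive x 1 (F \o -%R) (f (- x) * -1).
    exact: is_derive1_comp.
  by have := is_deriveN dFN; rewrite mulrN1 opprK.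
have cG : continuous (f \o -%R).
  by move=> x; apply: continuous_comp; [exact: opp_continuous|exact: cf].
rewrite (ge0_continuous_FTC2y_is_derive 0 (fun x => f0 (- x)) cG dG (l := - l')).
  by rewrite -EFinD; congr EFin; rewrite oppr0; ring.
by apply: cvgN; exact/cvgNy_compNP.
Qed.

Lemma oneDsqr_gt0 (x : R) : 0 < 1 + x ^+ 2.
Proof. by rewrite ltr_pwDl// sqr_ge0. Qed.

Lemma cvgy_oneDsqrV : (1 + x ^+ 2 : R)^-1 @[x --> +oo] --> (0:R).
Proof.
have : (x : R)^-1 @[x --> +oo] --> (0:R).
  apply/gtr0_cvgV0; last exact: cvg_id.
  exact: nbhs_pinfty_gt.
apply: (@squeeze_cvgr _ _ _ _ (cst 0)); last exact: cvg_cst.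
near=> x => /=.
have x1 : 1 <= x by near: x; exact: nbhs_pinfty_ge.
have ? : 0 < x by lra.
by rewrite invr_ge0 lef_pV2 ?posrE; nra.
Unshelve. all: by end_near. Qed.

Lemma cvgy_id_oneDsqrV : x / (1 + x ^+ 2 : R) @[x --> +oo] --> (0:R).
Proof.
have : (x : R)^-1 @[x --> +oo] --> (0:R).
  apply/gtr0_cvgV0; last exact: cvg_id.
  exact: nbhs_pinfty_gt.
apply: (@squeeze_cvgr _ _ _ _ (cst 0)); last exact: cvg_cst.
near=> x => /=.
have x1 : 1 <= x by near: x; exact: nbhs_pinfty_ge.
have ? : 0 < x by lra.
apply/andP; split; first by rewrite divr_ge0; nra.
by rewrite ler_pdivrMr ?ler_pdivlMl; nra.
Unshelve. all: by end_near. Qed.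

Lemma cvgy_ln_ratio (k w : R) : 0 < k ->
  ln ((1 + (k * x - w) ^+ 2) / (1 + x ^+ 2)) @[x --> +oo] --> ln (k ^+ 2).
Proof.
move=> k0; apply: continuous_cvg.
  by apply: continuous_ln; rewrite exprn_gt0.
(* Euclidean division of the numerator by 1 + x^2; the remainder terms vanish at infinity. *)
have -> : (fun x : R => (1 + (k * x - w) ^+ 2) / (1 + x ^+ 2)) =
   (fun x => k ^+ 2 + ((1 + w ^+ 2 - k ^+ 2) * (1 + x ^+ 2)^-1
                - (2 * k * w) * (x / (1 + x ^+ 2)))).
  apply/funext => x.
  have ? := lt0r_neq0 (oneDsqr_gt0 x).
  by field.
rewrite -[X in _ --> X]addr0; apply: cvgD; first exact: cvg_cst.
rewrite -[X in _ --> X]subr0; apply: cvgB.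
  rewrite -(mulr0 (1 + w ^+ 2 - k ^+ 2)).
  by apply: cvgMl_tmp; exact: cvgy_oneDsqrV.
by rewrite -(mulr0 (2 * k * w)); apply: cvgMl_tmp; exact: cvgy_id_oneDsqrV.
Qed.

Lemma cvgy_atan_affine (k w : R) : 0 < k ->
  atan (k * x - w) @[x --> +oo] --> pi / 2.
Proof.
move=> k0.
have kxw : (fun x : R => k * x - w : R) @ +oo --> +oo.
  apply/cvgryPge => A; near=> x.
  rewrite lerBrDr -ler_pdivrMl//.
exact: (cvg_comp _ _ kxw (@cvgy_atan R)).
Unshelve. all: by end_near. Qed.

(** A primitive of (al x + be)/(1 + x^2) + k (de - al (k x - w))/(1 + (k x - w)^2). A kernel of
    order x^-4 forces opposite coefficients on the two logarithms, hence a single logarithm of a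
    ratio, with finite limits at both ends. *)
Let Pfd (k w al be de x : R) : R :=
  be * atan x + de * atan (k * x - w)
   - (al / 2) * ln ((1 + (k * x - w) ^+ 2) / (1 + x ^+ 2)).

Let Pfd_y k w al be de : 0 < k -> Pfd k w al be de x @[x --> +oo] -->
  (be + de) * (pi / 2) - (al / 2) * ln (k ^+ 2).
Proof.
move=> k0; rewrite mulrDl; apply: cvgB; first apply: cvgD.
- by apply: cvgMl_tmp; exact: cvgy_atan.
- by apply: cvgMl_tmp; exact: cvgy_atan_affine.
- by apply: cvgMl_tmp; exact: cvgy_ln_ratio.
Qed.

(** Reflection turns (w, be, de) into (-w, -be, -de), which reduces this limit to the one at +oo. *)
Let Pfd_Ny k w al be de : 0 < k -> Pfd k w al be de x @[x --> -oo] -->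
  - ((be + de) * (pi / 2)) - (al / 2) * ln (k ^+ 2).
Proof.
move=> k0; apply/cvgNy_compNP.
have -> : Pfd k w al be de \o -%R = Pfd k (- w) al (- be) (- de).
  apply/funext => x; rewrite /Pfd /= atanN sqrrN.
  have -> : k * - x - w = - (k * x - - w) by ring.
  by rewrite atanN sqrrN !mulrN !mulNr.
by rewrite -mulNr opprD; exact: Pfd_y.
Qed.

(** The hypothesis is the partial fraction identity at x with denominators cleared; the coefficients
    stay abstract until [integral_cauchy_kernel] supplies them. *)
Let is_derive_Pfd (k w al be de : R) (x : R) :
  (al * x + be) * (1 + (k * x - w) ^+ 2) +
    k * (de - al * (k * x - w)) * (1 + x ^+ 2) = 1 ->
  is_derive x 1 (Pfd k w al be de)
    ((1 + x ^+ 2) * (1 + (k * x - w) ^+ 2))^-1.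
Proof.
move=> H.
have X0 := oneDsqr_gt0 x; have Y0 := oneDsqr_gt0 (k * x - w).
have daff : is_derive x 1 (fun x : R => k * x - w) k.
  by apply: is_derive_eq; rewrite /GRing.scale/=; ring.
have datan : is_derive x 1 (fun x : R => atan (k * x - w)) ((1 + (k * x - w) ^+ 2)^-1 * k).
  apply: (@is_derive1_comp _ atan) => //.
have dratio : is_derive x 1 (fun x : R => (1 + (k * x - w) ^+ 2) / (1 + x ^+ 2))
   ((2 * k * (k * x - w)) / (1 + x ^+ 2) - (1 + (k * x - w) ^+ 2) * (2 * x) / (1 + x ^+ 2) ^+ 2).
  have X1 : 1 + x ^+ 2 != 0 by exact: lt0r_neq0.
  have dX : is_derive x 1 (fun x : R => 1 + x ^+ 2) (2 * x).
    by apply: is_derive_eq; rewrite /GRing.scale/=; ring.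
  have dY : is_derive x 1 (fun x : R => 1 + (k * x - w) ^+ 2) (2 * k * (k * x - w)).
    by apply: is_derive_eq; rewrite /GRing.scale/=; ring.
  have dXV : is_derive x 1 (fun x : R => (1 + x ^+ 2)^-1) (- (1 + x ^+ 2) ^- 2 *: (2 * x)).
    exact: is_deriveV.
  by apply: is_derive_eq; rewrite /GRing.scale/=; field.
have dln : is_derive x 1 (fun x : R => ln ((1 + (k * x - w) ^+ 2) / (1 + x ^+ 2)))
   (((1 + (k * x - w) ^+ 2) / (1 + x ^+ 2))^-1 *
    ((2 * k * (k * x - w)) / (1 + x ^+ 2) -
     (1 + (k * x - w) ^+ 2) * (2 * x) / (1 + x ^+ 2) ^+ 2)).
  apply: (@is_derive1_comp _ (@ln R)) => //.
  by apply: is_derive1_ln; rewrite divr_gt0.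
rewrite /Pfd.
apply: is_derive_eq; rewrite /GRing.scale/=.
rewrite -[RHS]mul1r -[X in _ = X * _]H; field.
by rewrite !lt0r_neq0.
Qed.

Lemma continuous_cauchy_kernel (k w : R) :
  continuous (fun x : R => ((1 + x ^+ 2) * (1 + (k * x - w) ^+ 2))^-1).
Proof.
move=> x; apply: cvgV; first by rewrite lt0r_neq0// mulr_gt0// oneDsqr_gt0.
apply: cvgM; first exact: continuous_oneDsqr.
apply: (@continuous_comp _ _ _ (fun x : R => k * x - w) (fun x => 1 + x ^+ 2)).
  by apply: cvgB; [apply: cvgMl_tmp; exact: cvg_id | exact: cvg_cst].
exact: continuous_oneDsqr.
Qed.

(* The logarithmic terms of the partial fraction primitive have the same limit
   at -oo and +oo, so only the arctangents contribute. At w = 0 and k = 1 the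
   two quadratic factors coincide and the decomposition breaks down. *)
Lemma integral_cauchy_kernel (k w : R) : 0 < k -> w != 0 ->
  (\int[leb]_x (((1 + x ^+ 2) * (1 + (k * x - w) ^+ 2))^-1)%:E =
   (pi * (k + 1) / ((k + 1) ^+ 2 + w ^+ 2))%:E)%E.
Proof.
move=> k0 w0.
(* At x = i the cleared identity reads (be + al i)(q - 2 k w i) = 1, and [den] is the squared
   modulus of q - 2 k w i; [de] is chosen to cancel the x^2 term. *)
pose q := 1 + w ^+ 2 - k ^+ 2; pose den := q ^+ 2 + 4 * k ^+ 2 * w ^+ 2.
pose be := q / den; pose al := 2 * k * w / den; pose de := w * al - k * be.
have w2 : 0 < w ^+ 2 by rewrite exprn_even_gt0.
have den0 : 0 < den by rewrite /den ltr_wpDl ?sqr_ge0// mulr_gt0// mulr_gt0// exprn_gt0.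
have dF (x : R) : is_derive x 1 (Pfd k w al be de)
    ((1 + x ^+ 2) * (1 + (k * x - w) ^+ 2))^-1.
  apply: is_derive_Pfd; rewrite /de /be /al /den /q; field.
  by move: den0; rewrite /den /q => /lt0r_neq0.
rewrite (ge0_continuous_FTC2T _ (@continuous_cauchy_kernel k w) dF
  (@Pfd_y k w al be de k0) (@Pfd_Ny k w al be de k0)); last first.
  by move=> x; rewrite invr_ge0 mulr_ge0// ltW// oneDsqr_gt0.
congr EFin.
(* The numerator of be + de over [den] is (k + 1)((k - 1)^2 + w^2), so the second factor cancels. *)
have den_factor : den = ((k + 1) ^+ 2 + w ^+ 2) * ((k - 1) ^+ 2 + w ^+ 2).
  by rewrite /den /q; ring.
have f1 : (k + 1) ^+ 2 + w ^+ 2 != 0 by rewrite lt0r_neq0// ltr_wpDl// sqr_ge0.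
have f2 : (k - 1) ^+ 2 + w ^+ 2 != 0 by rewrite lt0r_neq0// ltr_wpDl// sqr_ge0.
have -> : (be + de) * (pi / 2) - al / 2 * ln (k ^+ 2) -
  (- ((be + de) * (pi / 2)) - al / 2 * ln (k ^+ 2)) = (be + de) * pi by field.
by rewrite /de /be /al den_factor /q; field; rewrite f1 f2.
Qed.

End real_line_integrals.

(** * Affine substitution in Lebesgue integrals *)

Section affine_change_of_variables.
Context {R : realType}.
Local Notation leb := (@lebesgue_measure R).
Local Open Scope classical_set_scope.
Local Open Scope ereal_scope.

Lemma measurable_affine (m t : R) :
  measurable_fun setT (fun x : measurableTypeR R => m * x + t : measurableTypeR R)%R.
Proof. by apply: measurable_funD => //; exact: measurable_funM. Qed.

(** The image of Lebesgue measure under x -> m x + t, multiplied by m, agrees with Lebesgue measure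
    on half-open intervals and hence everywhere. *)
Lemma ge0_integral_affine (m t : R) (f : R -> \bar R) : (0 < m)%R ->
  measurable_fun setT f -> (forall x, 0 <= f x) ->
  \int[leb]_x f x = m%:E * \int[leb]_x f (m * x + t)%R.
Proof.
move=> m0 mf f0.
pose aff (x : measurableTypeR R) : measurableTypeR R := (m * x + t)%R.
have maff : measurable_fun setT aff by exact: measurable_affine.
pose mn : {nonneg R} := NngNum (ltW m0).
pose pf : {measure set (measurableTypeR R) -> \bar R} :=
  measure_function_pushforward__canonical__measure_function_Measure leb maff.
pose nu := mscale mn pf.
have lebE A : measurable A -> leb A = nu A.
  apply: lebesgue_measure_unique => _ [[a b]] _ <-.
  rewrite -[RHS]/(m%:E * leb (aff @^-1` `]a, b]%classic)).
  have -> : aff @^-1` `]a, b] = `]((a - t) / m)%R, ((b - t) / m)%R]%classic.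
    apply/seteqP; split => x; rewrite /aff/= !in_itv/= ltr_pdivrMr// ler_pdivlMr// mulrC.
      by rewrite ltrBlDr lerBrDr.
    by rewrite ltrBlDr lerBrDr.
  rewrite !lebesgue_measure_itv/= !lte_fin ltr_pM2r ?invr_gt0// ltrD2r.
  case: ifP => _; last by rewrite mule0.
  rewrite -!EFinD -EFinM; congr EFin; field; exact: lt0r_neq0.
transitivity (\int[nu]_x f x); first by apply: eq_measure_integral => /= A mA _; exact: lebE.
by rewrite ge0_integral_mscale//= ge0_integral_pushforward.
Qed.

End affine_change_of_variables.

(** * Integration against a measure given by a density *)

Section density.
Context {R : realType}.
Local Notation leb := (@lebesgue_measure R).
Local Open Scope classical_set_scope.
Local Open Scope ereal_scope.

(** The density formula makes [mu] absolutely continuous and identifies p almost everywhere with its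
    Radon-Nikodym derivative. *)
Lemma ge0_integral_density (mu : probability (measurableTypeR R) R) (p : R -> R)
    (f : R -> \bar R) :
  measurable_fun setT p ->
  (forall A : set (measurableTypeR R), measurable A -> mu A = \int[leb]_(x in A) (p x)%:E) ->
  measurable_fun setT f -> (forall x, 0 <= f x) ->
  \int[mu]_x f x = \int[leb]_x (f x * (p x)%:E).
Proof.
move=> mp muE mf f0.
have dom : mu `<< leb.
  apply/null_content_dominatesP => A mA lebA0; rewrite muE//; apply: null_set_integral => //.
  exact/measurable_funTS/measurable_EFinP.
rewrite -(Radon_Nikodym_SigmaFinite.change_of_variables dom)//.
apply: ae_eq_integral => //.
- apply: emeasurable_funM => //.
  exact: measurable_int (Radon_Nikodym_SigmaFinite.f_integrable dom).
- by apply: emeasurable_funM => //; exact/measurable_EFinP.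
apply: ae_eqe_mul2l; apply: integral_ae_eq => //.
- exact: Radon_Nikodym_SigmaFinite.f_integrable.
- exact/measurable_EFinP.
- by move=> E _ mE; rewrite -Radon_Nikodym_SigmaFinite.f_integral//; exact: muE.
Qed.

End density.

(** * The Cauchy law and its stability under addition *)

Section cauchy_law.
Context {R : realType}.
Local Notation RT := (measurableTypeR R).
Local Notation leb := (@lebesgue_measure R).
Local Open Scope classical_set_scope.

Lemma cauchy_pdf_gt0 (x : R) : 0 < cauchy_pdf x.
Proof. by rewrite invr_gt0 mulr_gt0 ?pi_gt0 ?oneDsqr_gt0. Qed.

Lemma continuous_cauchy_pdf : continuous (@cauchy_pdf R).
Proof.
move=> x; apply: cvgV; first by rewrite lt0r_neq0// mulr_gt0 ?pi_gt0 ?oneDsqr_gt0.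
by apply: cvgMl_tmp; exact: continuous_oneDsqr.
Qed.

Lemma measurable_cauchy_pdf : measurable_fun setT (@cauchy_pdf R).
Proof. by apply: continuous_measurable_fun; exact: continuous_cauchy_pdf. Qed.

(** The integral is the density at z of (k U + V)/(k + 1) for independent standard Cauchy U and V.
    With w = (k + 1) z, the denominator (k + 1)^2 + w^2 of the kernel integral becomes (k + 1)^2 (1
    + z^2). *)
Lemma cauchy_pdf_convolution (k z : R) : 0 < k -> z != 0 ->
  (\int[leb]_x ((k + 1) * (cauchy_pdf ((k + 1) * z - k * x) * cauchy_pdf x))%:E
   = (cauchy_pdf z)%:E)%E.
Proof.
move=> k0 z0; pose w := (k + 1) * z.
have k1 : 0 < k + 1 by rewrite ltr_wpDl// ltW.
have w0 : w != 0 by rewrite mulf_neq0// lt0r_neq0.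
have pi0 := @pi_gt0 R.
transitivity (\int[leb]_x (((k + 1) / pi ^+ 2)%:E *
    (((1 + x ^+ 2) * (1 + (k * x - w) ^+ 2))^-1)%:E))%E.
  apply: eq_integral => x _; rewrite -EFinM; congr EFin.
  have X0 := lt0r_neq0 (oneDsqr_gt0 x).
  have Y0 := lt0r_neq0 (oneDsqr_gt0 (k * x - w)).
  rewrite /cauchy_pdf -/w; have -> : (w - k * x) ^+ 2 = (k * x - w) ^+ 2 by ring.
  by move: (@pi R) (lt0r_neq0 pi0) => p p0; field; rewrite X0 Y0 p0.
rewrite ge0_integralZl//; last 3 first.
- apply/measurable_EFinP; apply: continuous_measurable_fun.
  exact: continuous_cauchy_kernel.
- by move=> x _; rewrite lee_fin invr_ge0 mulr_ge0// ltW// oneDsqr_gt0.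
- by rewrite lee_fin divr_ge0// ?sqr_ge0// ltW.
rewrite integral_cauchy_kernel// -EFinM; congr EFin.
have -> : (k + 1) ^+ 2 + w ^+ 2 = (k + 1) ^+ 2 * (1 + z ^+ 2) by rewrite /w; ring.
have z1 := lt0r_neq0 (oneDsqr_gt0 z).
rewrite /cauchy_pdf; move: (@pi R) (lt0r_neq0 pi0) => p p0.
by field; rewrite z1 p0 lt0r_neq0.
Qed.

Variable mu : probability (measurableTypeR R) R.
Hypothesis muE : forall A : set RT, measurable A ->
  mu A = (\int[leb]_(x in A) (cauchy_pdf x)%:E)%E.

(** For k > 0, substituting y = (k + 1) z - k x makes the indicator of A independent of x;
    Fubini-Tonelli then leaves the convolution integral at each z. *)
Lemma cauchy_law_stable (k : R) (A : set RT) : 0 <= k -> measurable A ->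
  (\int[mu]_x mu [set y : RT | A (k * x + y)%R] = mu [set z : RT | A ((k + 1) * z)%R])%E.
Proof.
rewrite le_eqVlt => /predU1P[<-|k0] mA.
  (* At k = 0, where the convolution identity does not apply, both sides are [mu A]. *)
  rewrite (eq_integral (cst (mu A))) => [|x _].
    rewrite integral_cst// [X in (_ * X)%E](_ : _ = 1%E); last exact: probability_setT.
    rewrite mule1; congr (mu _).
    by apply/seteqP; split => z /=; rewrite add0r mul1r.
  by congr (mu _); apply/seteqP; split => z /=; rewrite mul0r add0r.
have k1 : 0 < k + 1 by rewrite ltr_wpDl// ltW.
have maff (m t : R) : measurable_fun setT (fun x : RT => m * x + t : RT).
  by apply: measurable_funD => //; exact: measurable_funM.
have mind d' (T' : measurableType d') (f : T' -> RT) :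
    measurable_fun setT f -> measurable_fun setT (fun x : T' => \1_A (f x) : R).
  by move=> mf; apply: (measurableT_comp _ mf); exact: measurable_indic.
(* The integrand in the coordinates (x, z); the [k + 1] in front of the densities is the Jacobian of
   z -> (k + 1) z - k x. *)
pose h (u : RT * RT) : R := \1_A ((k + 1) * u.2) *
   ((k + 1) * (cauchy_pdf ((k + 1) * u.2 - k * u.1) * cauchy_pdf u.1)).
have h0 u : 0 <= h u.
  by rewrite /h !mulr_ge0// ltW// cauchy_pdf_gt0.
have mh : measurable_fun setT (EFin \o h).
  apply/measurable_EFinP; apply: measurable_funM.
    apply: mind; exact: measurable_funM.
  apply: measurable_funM => //; apply: measurable_funM.
    apply: (measurableT_comp measurable_cauchy_pdf).
    by apply: measurable_funB; exact: measurable_funM.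
  by apply: (measurableT_comp measurable_cauchy_pdf).
have mpre (m t : R) : measurable [set y : RT | A (m * y + t)].
  by rewrite -[X in measurable X]setTI; exact: maff.
have muE_indic B : measurable B ->
    (mu B = \int[leb]_y (\1_B y * cauchy_pdf y)%:E)%E.
  move=> mB; rewrite muE// integral_mkcond; apply: eq_integral => y _.
  by rewrite patchE indicE; case: ifPn; rewrite ?mul1r ?mul0r.
have ind_pre (f : RT -> RT) y : \1_[set y : RT | A (f y)] y = \1_A (f y) :> R.
  by rewrite !indicE; congr (_%:R); congr nat_of_bool; apply/idP/idP; rewrite !inE.
have section (x : RT) : (mu [set y : RT | A (k * x + y)%R] * (cauchy_pdf x)%:E =
   \int[leb]_z (h (x, z))%:E)%E.
  have eB : [set y : RT | A (k * x + y)] = [set y : RT | A (1 * y + k * x)].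
    by apply/seteqP; split => y /=; rewrite mul1r addrC.
  have mB : measurable [set y : RT | A (k * x + y)] by rewrite eB; exact: mpre.
  have mg : measurable_fun setT (fun y : RT =>
      (\1_[set y : RT | A (k * x + y)] y * cauchy_pdf y)%:E).
    apply/measurable_EFinP; apply: measurable_funM => //.
    exact: measurable_cauchy_pdf.
  rewrite muE_indic// (ge0_integral_affine (- (k * x)) k1 mg); last first.
    by move=> y; rewrite lee_fin mulr_ge0// ltW// cauchy_pdf_gt0.
  rewrite muleAC -EFinM -ge0_integralZl//; last 3 first.
  - exact: (measurableT_comp mg (maff _ _)).
  - by move=> y _; rewrite lee_fin mulr_ge0// ltW// cauchy_pdf_gt0.
  - by rewrite lee_fin mulr_ge0 ?ltW// cauchy_pdf_gt0.
  apply: eq_integral => z _; rewrite -EFinM; congr EFin.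
  rewrite /h (ind_pre (fun y => k * x + y))/=.
  have -> : k * x + ((k + 1) * z + - (k * x)) = (k + 1) * z by ring.
  by ring.
have msec : measurable_fun setT (fun x : RT => mu [set y : RT | A (k * x + y)%R]).
  have mW : measurable [set u : RT * RT | A (k * u.1 + u.2)].
    rewrite -[X in measurable X]setTI.
    have : measurable_fun setT (fun u : RT * RT => k * u.1 + u.2 : RT).
      by apply: measurable_funD => //; exact: measurable_funM.
    exact.
  have := measurable_fun_xsection mu mW; congr measurable_fun.
  by apply/funext => x /=; congr (mu _); apply/seteqP; split => y; rewrite /xsection/= inE.
rewrite (ge0_integral_density measurable_cauchy_pdf muE)//.
under eq_integral do rewrite section.
have h0E u : (0 <= (EFin \o h) u)%E by rewrite lee_fin.
rewrite (fubini_tonelli (EFin \o h) mh h0E)/=.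
have mA1 : measurable [set z : RT | A ((k + 1) * z)].
  have -> : [set z : RT | A ((k + 1) * z)] = [set z : RT | A ((k + 1) * z + 0)].
    by apply/seteqP; split => z /=; rewrite addr0.
  exact: mpre.
rewrite muE_indic//; apply: ae_eq_integral => //.
- exact: (measurable_fun_fubini_tonelli_G (EFin \o h) mh h0E).
- apply/measurable_EFinP; apply: measurable_funM => //.
  exact: measurable_cauchy_pdf.
exists [set 0]; split => //; first exact: lebesgue_measure_set1.
move=> z /= H; apply/eqP/negPn/negP => z0; apply: H => _.
rewrite EFinM -(cauchy_pdf_convolution k0 z0).
rewrite -ge0_integralZl//.
  apply/measurable_EFinP; apply: measurable_funM => //; apply: measurable_funM.
    apply: (measurableT_comp measurable_cauchy_pdf).
    by apply: measurable_funB => //; exact: measurable_funM.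
  exact: measurable_cauchy_pdf.
by move=> x _; rewrite lee_fin !mulr_ge0// ltW// cauchy_pdf_gt0.
Qed.

End cauchy_law.

(** * Joint laws recovered from product formulas *)

Section joint_law.
Context d d1 d2 (T : measurableType d) (T1 : measurableType d1)
  (T2 : measurableType d2) (R : realType) (P : probability T R).
Variables (m1 : probability T1 R) (m2 : probability T2 R).
Variables (X : T -> T1) (Y : T -> T2).
Hypotheses (mX : measurable_fun setT X) (mY : measurable_fun setT Y).
Local Open Scope classical_set_scope.
Local Open Scope ereal_scope.

(** Full A and B give q = P E. If q = 0 both sides vanish; otherwise the law of (X, Y) restricted to
    E and divided by q agrees with the product measure on rectangles, which determine it. *)
Lemma joint_law_unique (E : set T) (q : \bar R) : measurable E ->
  (forall A B, measurable A -> measurable B ->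
    P (E `&` X @^-1` A `&` Y @^-1` B) = q * m1 A * m2 B) ->
  forall W, measurable W -> P (E `&` [set w | W (X w, Y w)]) = q * (m1 \x m2) W.
Proof.
move=> mE HE W mW.
have qE : q = P E.
  by rewrite -[E]setIT -[E `&` _]setIT -(preimage_setT X) -[X in _ `&` X](preimage_setT Y)
    HE// !probability_setT !mule1.
have mXY : measurable_fun setT (fun w => (X w, Y w)) by exact: measurable_fun_pair.
have mXYW V : measurable V -> measurable [set w | V (X w, Y w)].
  by move=> mV; rewrite -[X in measurable X]setTI; exact: mXY.
have qfin : q \is a fin_num by rewrite qE fin_num_measure.
have q0 : 0 <= q by rewrite qE.
have [q00|qn0] := eqVneq q 0.
  rewrite q00 mul0e; apply/eqP; rewrite -measure_le0 -q00 qE.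
  by apply: le_measure; rewrite ?inE//; apply: measurableI => //; exact: mXYW.
have qr0 : (0 <= (fine q)^-1)%R by rewrite invr_ge0 fine_ge0.
pose qn : {nonneg R} := NngNum qr0.
pose pf : {measure set (T1 * T2) -> \bar R} :=
  measure_function_pushforward__canonical__measure_function_Measure (mrestr P mE) mXY.
have mV V : mscale qn pf V = (fine q)^-1%:E * P (E `&` [set w | V (X w, Y w)]).
  by rewrite setIC.
have qK : (fine q)^-1%:E * q = 1.
  by rewrite -[q in _ * q](fineK qfin) -EFinM mulVf// fine_eq0.
rewrite [X in q * X](_ : _ = (fine q)^-1%:E * P (E `&` [set w | W (X w, Y w)])).
  by rewrite muleA [q * _]muleC qK mul1e.
apply: etrans _ (mV W).
apply: product_measure_unique => // A B mA mB.
apply: etrans (mV _) _.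
have -> : E `&` [set w | (A `*` B) (X w, Y w)] = E `&` X @^-1` A `&` Y @^-1` B.
  by rewrite -setIA.
by rewrite HE// !muleA qK mul1e.
Qed.

End joint_law.

(** * Multiples of the Cauchy law *)

Section scaled_law.
Context {R : realType}.
Local Notation RT := (measurableTypeR R).

(* The image of the Cauchy law by scaler 0 is the Dirac mass at 0, so that the
   sums over empty index sets need no separate treatment. *)
Definition scaler (k : R) (x : RT) : RT := k * x.

Lemma measurable_scaler k : measurable_fun setT (scaler k).
Proof. by apply: measurable_funM. Qed.

HB.instance Definition _ k :=
  isMeasurableFun.Build _ _ _ _ (scaler k) (measurable_scaler k).

End scaled_law.

(** * Laws of sums of independent Cauchy variables *)

Section sums_of_cauchy.
Context d (T : measurableType d) (R : realType) (P : probability T R).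
Local Notation RT := (measurableTypeR R).
Variable mu : probability RT R.
Hypothesis muE : forall A : set RT, measurable A ->
  mu A = (\int[lebesgue_measure]_(x in A) (cauchy_pdf x)%:E)%E.
Context {I : eqType} (X : I -> T -> RT).
Hypothesis mX : forall i, measurable_fun setT (X i).
Local Open Scope classical_set_scope.
Local Open Scope ereal_scope.

Let law (k : R) : probability RT R := distribution mu (scaler k).

(* The event E, of probability q, and the variables X i for i in s (listed
   without repetition) are mutually independent, each X i having law mu.
   Recursion on s lets a partial sum be absorbed into E one term at a time. *)
Fixpoint chain (E : set T) (q : \bar R) (s : seq I) : Prop :=
  if s is i :: s' then
    forall B, measurable B -> chain (E `&` X i @^-1` B) (q * mu B) s'
  else P E = q.

Lemma chain_set0 s : chain set0 0 s.
Proof.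
elim: s => [|i s IHs] /=; first exact: measure0.
by move=> B _; rewrite set0I mul0e.
Qed.

(** Induction on s absorbs the remaining variables into E; once none is left, [joint_law_unique]
    gives the joint law of S and X i on E, and [cauchy_law_stable] the law of their sum. *)
Lemma chain_merge (S : T -> RT) (k : R) i s E q :
  measurable_fun setT S -> (0 <= k)%R -> measurable E ->
  (forall A B, measurable A -> measurable B ->
     chain (E `&` S @^-1` A `&` X i @^-1` B) (q * law k A * mu B) s) ->
  forall A, measurable A ->
     chain (E `&` [set w | A (S w + X i w)%R]) (q * law (k + 1) A) s.
Proof.
move=> mS k0; elim: s E q => [|j s IHs] E q mE HE A mA /=.
  have mW : measurable [set u : RT * RT | A (u.1 + u.2)%R].
    rewrite -[X in measurable X]setTI.
    have : measurable_fun setT (fun u : RT * RT => u.1 + u.2 : RT)%R.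
      exact: measurable_funD.
    exact.
  rewrite (joint_law_unique mS (mX i) mE HE mW); congr (_ * _).
  transitivity (\int[mu]_x mu [set y : RT | A (k * x + y)%R]); last first.
    exact: cauchy_law_stable.
  rewrite /product_measure1 ge0_integral_distribution//=.
    apply: eq_integral => x _ /=; congr (mu _).
    by apply/seteqP; split => y; rewrite /xsection/= inE.
  exact: measurable_fun_xsection.
move=> C mC; rewrite setIAC muleAC.
apply: IHs => //.
  by apply: measurableI => //; rewrite -[X in measurable X]setTI; exact: mX.
move=> A' B mA' mB.
rewrite (setIAC E) (setIAC (E `&` _)) (muleAC q) (muleAC (q * _)).
exact: HE.
Qed.

Let law0 A : measurable A -> law 0 A = (\1_A (0%R : RT))%:E.
Proof.
move=> mA; rewrite -[LHS]/(mu (scaler 0 @^-1` A)) indicE.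
have [A0|A0] := boolP (_ \in A).
  rewrite (_ : scaler 0 @^-1` A = setT); first exact: probability_setT.
  by apply/seteqP; split => // x _ /=; rewrite /scaler mul0r; rewrite inE in A0.
rewrite (_ : scaler 0 @^-1` A = set0) ?measure0//.
apply/seteqP; split => // x /=.
by rewrite /scaler mul0r => A0'; move: A0; rewrite notin_setE.
Qed.

(** The accumulator S holds the sum so far; each further term raises its scale k by one through
    [chain_merge]. *)
Let chain_sum_from (S : T -> RT) (k : R) s s' E q :
  measurable_fun setT S -> (0 <= k)%R -> measurable E ->
  (forall A, measurable A -> chain (E `&` S @^-1` A) (q * law k A) (s ++ s')) ->
  forall A, measurable A ->
    chain (E `&` [set w | A (S w + \sum_(i <- s) X i w)%R])
      (q * law (k + (size s)%:R) A) s'.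
Proof.
elim: s S k => [|i s IHs] S k mS k0 mE HE A mA /=.
  rewrite addr0 [X in E `&` X](_ : _ = S @^-1` A); first exact: HE.
  by apply/seteqP; split => w /=; rewrite big_nil addr0.
rewrite (_ : k + (size s).+1%:R = k + 1 + (size s)%:R)%R; last first.
  by rewrite -addrA -natr1 [(1 + _)%R]addrC.
rewrite [X in E `&` X](_ : _ = [set w | A ((S w + X i w) + \sum_(j <- s) X j w)%R]).
  have mSX : measurable_fun setT (fun w => S w + X i w : RT)%R.
    exact: measurable_funD mS (mX i).
  apply: (IHs _ _ mSX) => //; first by rewrite addr_ge0.
  move=> A' mA'; apply: (chain_merge mS k0 mE _ mA') => A1 B1 mA1 mB1.
  exact: HE.
by apply/seteqP; split => w /=; rewrite big_cons addrA.
Qed.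

(** Keeping the tail s' in the conclusion lets successive blocks be summed by repeated
    application. *)
Lemma chain_sum s s' E q : measurable E -> chain E q (s ++ s') ->
  forall A, measurable A ->
    chain (E `&` [set w | A (\sum_(i <- s) X i w)%R]) (q * law (size s)%:R A) s'.
Proof.
move=> mE HE A mA.
have := @chain_sum_from (cst 0%R) 0%R s s' E q (measurable_cst _) (lexx _) mE.
rewrite add0r => /(_ _ A mA).
rewrite [X in chain (E `&` X)](_ : _ = [set w | A (\sum_(i <- s) X i w)%R]); last first.
  by apply/seteqP; split => w /=; rewrite add0r.
(* The initial accumulator is the constant 0: its event is full or empty according to whether 0 lies
   in B. *)
apply => B mB; rewrite law0// preimage_cst indicE; case: ifPn => _.
  by rewrite setIT mule1.
by rewrite setI0 mule0; exact: chain_set0.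
Qed.

End sums_of_cauchy.

(** * Disagreement of positivity under a product of Cauchy laws *)

Lemma neqb_xor (p q : bool) : p != q <-> p /\ ~ q \/ q /\ ~ p.
Proof. by case: p; case: q; split => //=; by [left|right|case=> -[]]. Qed.

Lemma measurable_neqb d (T : measurableType d) (f g : T -> bool) :
  measurable_fun setT f -> measurable_fun setT g ->
  measurable [set w | f w != g w]%classic.
Proof.
move=> mf mg.
have -> : [set w | f w != g w]%classic =
    (([set w | f w] `\` [set w | g w]) `|` ([set w | g w] `\` [set w | f w]))%classic.
  by apply/seteqP; split => w /neqb_xor.
have := mf measurableT [set true]%classic I; rewrite setTI => Mf.
have := mg measurableT [set true]%classic I; rewrite setTI => Mg.
by apply: measurableU; apply: measurableD.
Qed.

Section sign_disagreement.
Context {R : realType}.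
Local Notation RT := (measurableTypeR R).
Local Notation leb := (@lebesgue_measure R).
Variable mu : probability RT R.
Hypothesis muE : forall A : set RT, measurable A ->
  mu A = (\int[leb]_(x in A) (cauchy_pdf x)%:E)%E.
Local Open Scope classical_set_scope.
Local Open Scope ereal_scope.

Lemma cauchy_law_set1 (x : R) : mu [set x : RT] = 0.
Proof. by rewrite muE ?integral_set1//; exact: measurable_set1. Qed.

Lemma cauchy_law_halfline (a t : R) : (0 < a)%R ->
  mu [set s : RT | (0 < a * s + t)%R] = (1 / 2 + atan (t / a) / pi)%:E.
Proof.
move=> a0.
have -> : [set s : RT | (0 < a * s + t)%R] = `](- (t / a))%R, +oo[%classic.
  apply/seteqP; split => s /=;
    rewrite in_itv/= andbT -mulNr ltr_pdivrMr// [(s * a)%R]mulrC => ?; lra.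
rewrite muE; last exact: measurable_itv.
have mp : measurable_fun setT (fun x : RT => (cauchy_pdf x)%:E).
  by apply/measurable_EFinP; exact: measurable_cauchy_pdf.
rewrite integral_itv_obnd_cbnd; last exact: measurable_funTS.
have dF (x : R) : is_derive x 1%R (fun x : R => pi^-1 * atan x)%R (cauchy_pdf x).
  apply: is_derive_eq; rewrite /GRing.scale/= /cauchy_pdf invfM//.
rewrite (ge0_continuous_FTC2y_is_derive (- (t / a))%R _ (@continuous_cauchy_pdf R) dF
  (l := (pi^-1 * (pi / 2))%R)).
- congr EFin; rewrite atanN; move: (@pi_gt0 R) => /lt0r_neq0.
  by move: (atan _) (@pi R) => x p p0; field.
- by move=> x; apply/ltW/cauchy_pdf_gt0.
- by apply: cvgMl_tmp; exact: cvgy_atan.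
Qed.

(** Oddness of the arctangent moves the sign of t outside. For a = 0 the event is full or empty
    according to that sign, and the convention pi / 2 yields exactly 1/2 + 1/2 or 1/2 - 1/2. *)
Lemma cauchy_law_halfline_ratio (a c : nat) (t : R) : (0 < a + c)%N -> t != 0%R ->
  mu [set s : RT | (0 < a%:R * s + c%:R * t)%R] =
    (1 / 2 + Num.sg t * (atan_ratio c a `|t|) / pi)%:E.
Proof.
move=> ac t0; rewrite /atan_ratio; case: ifPn => [/eqP a0|a0].
  have c0 : (0 < c%:R :> R)%R by rewrite ltr0n; rewrite a0 in ac.
  have pi0 := lt0r_neq0 (@pi_gt0 R).
  have -> : (1 / 2 + Num.sg t * (pi / 2) / pi = (0 < t)%R%:R :> R)%R.
    move: (@pi R) pi0 => p p0.
    by case: sgrP t0 => //= _ _; field.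
  have [t1|t1] := ltP 0%R t.
    rewrite (_ : [set s | _] = setT); first exact: probability_setT.
    by apply/seteqP; split => // s _ /=; rewrite a0 mul0r add0r mulr_gt0.
  rewrite (_ : [set s | _] = set0) ?measure0//.
  by apply/seteqP; split => // s /=; rewrite a0 mul0r add0r pmulr_rgt0// ltNge t1.
rewrite cauchy_law_halfline ?ltr0n ?lt0n//; congr EFin; congr (_ + _ / _)%R.
rewrite -mulrA [(t / _)%R]mulrC mulrA -[in LHS](mulr_sg_norm t).
case: sgrP => t1; rewrite ?mul1r ?mul0r ?mulr0 ?atan0 ?mulN1r//.
by rewrite mulrN atanN.
Qed.

Let law (k : R) : probability RT R := distribution mu (scaler k).

Let alpha (c a : nat) (t : R) : R := atan_ratio c a `|t|.

(** The component [u.1] stands for the sum shared by x and y, [u.2.1] and [u.2.2] for the sums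
    private to each. *)
Let W : set (RT * (RT * RT)) :=
  [set u | (0 < u.2.1 + u.1)%R != (0 < u.2.2 + u.1)%R].

Lemma measurable_sign_disagreement : measurable W.
Proof.
by apply: measurable_neqb; apply: measurable_fun_ltr => //;
  apply: measurable_funD => //; exact: measurableT_comp.
Qed.

(** If p and p' are the two probabilities of positivity, disagreement has probability p (1 - p') +
    (1 - p) p'. The terms linear in the sign of t cancel, and in the product the sign is squared to
    1. *)
Let slice_law (a b c : nat) (t : R) : (0 < a + c)%N -> (0 < b + c)%N -> t != 0%R ->
  (law a%:R \x law b%:R) (xsection W (c%:R * t)%R) =
    (1 / 2 - 2 / pi ^+ 2 * (alpha c a t * alpha c b t))%:E.
Proof.
move=> ac bc t0.
pose U (n : nat) : set RT := [set s | (0 < s + c%:R * t)%R].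
have lawU n : (0 < n + c)%N -> law n%:R (U n) = (1 / 2 + Num.sg t * alpha c n t / pi)%:E.
  by move=> nc; rewrite -cauchy_law_halfline_ratio.
have mU n : measurable (U n).
  have mf : measurable_fun setT (fun s : RT => 0 < s + c%:R * t)%R.
    by apply: measurable_fun_ltr => //; exact: measurable_funD.
  by have := mf measurableT [set true] I; rewrite setTI.
have lawUC n : (0 < n + c)%N -> law n%:R (~` U n) = (1 / 2 - Num.sg t * alpha c n t / pi)%:E.
  move=> nc; rewrite probability_setC// lawU// -EFinB; congr EFin.
  by move: (@pi R) (lt0r_neq0 (@pi_gt0 R)) => p p0; field.
have -> : xsection W (c%:R * t)%R = (U a `*` ~` U b) `|` (~` U a `*` U b).
  apply/seteqP; split => -[s s']; rewrite /xsection/= inE/=.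
    by move=> /neqb_xor[[? ?]|[? ?]]; [left|right].
  by move=> H; apply/neqb_xor; case: H => -[? ?]; [left|right].
rewrite measureU//; last 3 first.
- exact: measurableX (mU _) (measurableC (mU _)).
- exact: measurableX (measurableC (mU _)) (mU _).
- by apply/seteqP; split => // -[s s'] /= [[]] ? ? [].
rewrite [X in X + _](_ : _ = law a%:R (U a) * law b%:R (~` U b)); last first.
  by apply: product_measure1E => //; exact: measurableC.
rewrite [X in _ + X](_ : _ = law a%:R (~` U a) * law b%:R (U b)); last first.
  by apply: product_measure1E => //; exact: measurableC.
rewrite !lawU// !lawUC// -!EFinM -EFinD; congr EFin.
have sg2 : (Num.sg t * Num.sg t = 1)%R by rewrite -expr2 sqr_sg t0.
transitivity (1 / 2 - 2 / pi ^+ 2 * ((Num.sg t * Num.sg t) * (alpha c a t * alpha c b t)))%R.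
  move: (@pi R) (lt0r_neq0 (@pi_gt0 R)) (Num.sg t) (alpha c a t) (alpha c b t).
  by move=> p p0 sg al be; field.
by rewrite sg2 !mul1r.
Qed.

Let alpha_ge0 c a t : (0 <= alpha c a t)%R.
Proof.
rewrite /alpha /atan_ratio; case: ifPn => _; first by rewrite divr_ge0// pi_ge0.
by rewrite -[X in (X <= _)%R]atan0; apply: le_atan; rewrite !mulr_ge0// invr_ge0.
Qed.

Let alpha_le c a t : (alpha c a t <= pi / 2)%R.
Proof.
by rewrite /alpha /atan_ratio; case: ifPn => // _; exact/ltW/atan_ltpi2.
Qed.

Let measurable_alpha c a : measurable_fun setT (alpha c a : RT -> R).
Proof.
rewrite /alpha /atan_ratio; case: eqP => _; first exact: measurable_cst.
apply: (@measurableT_comp _ _ _ RT _ _ (@atan R)).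
  by apply: continuous_measurable_fun => x; exact: continuous_atan.
by apply: measurable_funM => //; exact: measurableT_comp.
Qed.

Lemma sign_disagreement_law (a b c : nat) : (0 < a + c)%N -> (0 < b + c)%N ->
  (law c%:R \x (law a%:R \x law b%:R)) W =
  (1 / 2)%:E - (2 / pi ^+ 2)%:E *
    cauchy_expect (fun t : R => (atan_ratio c a `|t| * atan_ratio c b `|t|)%R).
Proof.
move=> ac bc.
pose g (t : RT) : R := (alpha c a t * alpha c b t)%R.
have g0 t : (0 <= g t)%R by rewrite mulr_ge0.
have mg : measurable_fun setT (fun t : RT => (g t)%:E).
  by apply/measurable_EFinP; exact: measurable_funM.
have K0 : (0 <= 2 / pi ^+ 2 :> R)%R by rewrite divr_ge0// sqr_ge0.
pose lab : probability (RT * RT)%type R := (law a%:R \x law b%:R).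
have mslice := measurable_fun_xsection lab measurable_sign_disagreement.
transitivity (\int[mu]_t (((1 / 2)%:E - (2 / pi ^+ 2)%:E * (g t)%:E))).
  rewrite [LHS]ge0_integral_distribution//=.
  apply: ae_eq_integral => //.
  - exact: (measurableT_comp mslice (measurable_scaler _)).
  - have mKg := measurable_funeM (2 / pi ^+ 2)%:E mg.
    exact: (emeasurable_funB (measurable_cst (1 / 2)%:E) mKg).
  (* The slice at t = 0 is discarded, [mu] having no atom there. *)
  exists [set 0%R]; split => //; first exact: cauchy_law_set1.
  move=> t /= H; apply/eqP/negPn/negP => t0; apply: H => _.
  by rewrite /scaler slice_law// -EFinM -EFinB.
(* Both arctangents are at most pi / 2; the resulting integrability permits splitting the integral
   of the difference. *)
have intg : mu.-integrable setT (fun t => (2 / pi ^+ 2)%:E * (g t)%:E).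
  apply: integrableZl => //.
  apply: (@le_integrable _ _ _ mu setT _ _ (EFin \o cst ((pi / 2) * (pi / 2)))%R) => //.
    move=> t _; rewrite lee_fin ger0_norm// (le_trans _ (ler_norm _))//.
    by rewrite ler_pM.
  exact: finite_measure_integrable_cst.
rewrite integralB//; last exact: finite_measure_integrable_cst.
congr (_ - _).
  rewrite integral_cst// [X in _ * X](_ : _ = 1); last exact: probability_setT.
  by rewrite mule1.
rewrite ge0_integralZl//; last by move=> t _; rewrite lee_fin.
congr (_ * _); rewrite (ge0_integral_density measurable_cauchy_pdf muE)//.
Qed.

End sign_disagreement.

(** * Joint law of sums over disjoint blocks of the sample *)

Section sample.
Context (R : realType) (d : measure_display) (T : measurableType d)
  (P : probability T R) (D : nat) (r : 'I_D -> {RV P >-> R}).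
Local Notation RT := (measurableTypeR R).
Variable mu : probability RT R.
Hypothesis muE : forall A : set RT, measurable A ->
  mu A = (\int[lebesgue_measure]_(x in A) (cauchy_pdf x)%:E)%E.
Hypothesis rE : forall i (A : set RT), measurable A -> P (r i @^-1` A)%classic = mu A.
Hypothesis indep : mutually_independent r.
Local Open Scope classical_set_scope.
Local Open Scope ereal_scope.

Let X (i : 'I_D) (w : T) : RT := r i w.

(** Mutual independence constrains all D variables at once. The indices in s are those still
    unconstrained, and each step of [chain] replaces one full set by a given B. *)
Lemma chain_mutually_independent (s : seq 'I_D) (F : 'I_D -> set RT) :
  uniq s -> (forall i, measurable (F i)) -> (forall i, i \in s -> F i = setT) ->
  chain P mu X (\bigcap_(i in [set: 'I_D]) (X i @^-1` F i)) (\prod_(i < D) mu (F i)) s.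
Proof.
elim: s F => [|j s IHs] F /=.
  move=> _ mF _; rewrite (indep mF).
  by apply: eq_bigr => i _; rewrite rE.
move=> /andP[js us] mF FT B mB.
pose F' i := if i == j then B else F i.
rewrite [X in chain _ _ _ X](_ : _ = \bigcap_(i in [set: 'I_D]) (X i @^-1` F' i)); last first.
  apply/seteqP; split => [w [Fw Bw] i _ /=|w F'w].
    by rewrite /F'; case: eqP => [->//|_]; exact: Fw.
  split => [i _|]; last by have := F'w j I; rewrite /F' /= eqxx.
  have := F'w i I; rewrite /F' /=; case: eqP => [->|//] _.
  by rewrite FT ?mem_head.
rewrite (_ : _ * _ = \prod_(i < D) mu (F' i)).
  apply: IHs => // i; rewrite /F'; first by case: eqP.
  case: eqP => [->|_ si]; first by rewrite (negbTE js).
  by rewrite FT// inE si orbT.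
rewrite (bigD1 j)//= [RHS](bigD1 j)//= /F' eqxx FT ?mem_head//.
rewrite [X in X * _ * _](_ : _ = 1); last exact: probability_setT.
rewrite mul1e muleC; congr (_ * _).
by apply: eq_bigr => i /negbTE ->.
Qed.

Let law (k : R) : probability RT R := distribution mu (scaler k).

Let mX i : measurable_fun setT (X i).
Proof. exact: (measurable_funP (r i)). Qed.

Let chain_sample (s : seq 'I_D) : uniq s -> chain P mu X setT 1 s.
Proof.
move=> us; have := @chain_mutually_independent s (fun=> setT) us.
rewrite [X in chain _ _ _ X](_ : _ = setT); last first.
  by apply/seteqP; split => // w _ i.
rewrite big1; first by apply.
by move=> i _; exact: probability_setT.
Qed.

(** A nonempty sum is distributed as a nonzero multiple of a Cauchy variable, whose law has no atom;
    this makes ties negligible. *)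
Lemma sum_cauchy_eq0 (s : seq 'I_D) : uniq s -> (0 < size s)%N ->
  P [set w | (\sum_(i <- s) r i w = 0)%R] = 0.
Proof.
move=> us s0.
have cs : chain P mu X setT 1 (s ++ [::]) by rewrite cats0; exact: chain_sample.
have := chain_sum muE mX measurableT cs (measurable_set1 0%R).
rewrite /= setTI mul1e => ->.
transitivity (mu [set 0%R : RT]); last exact: cauchy_law_set1.
congr (mu _); apply/seteqP; split => z /=; rewrite /scaler.
  by move=> /eqP; rewrite mulf_eq0 pnatr_eq0 -leqn0 leqNgt s0 => /eqP.
by move=> ->; rewrite mulr0.
Qed.

(** Three passes of [chain_sum] give the product formula on boxes. [joint_law_unique] is used twice,
    following the nesting of the triple: the inner use takes place inside the event that constrains
    the sum over sc. *)
Lemma three_sums_law (sa sb sc : seq 'I_D) (W : set (RT * (RT * RT))) :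
  uniq (sc ++ sa ++ sb) -> measurable W ->
  P [set w | W (\sum_(i <- sc) r i w, (\sum_(i <- sa) r i w, \sum_(i <- sb) r i w))%R] =
  (law (size sc)%:R \x (law (size sa)%:R \x law (size sb)%:R)) W.
Proof.
move=> us mW.
pose S s (w : T) : RT := (\sum_(i <- s) X i w)%R.
have mS s : measurable_fun setT (S s) by apply: measurable_sum.
pose lab : probability (RT * RT)%type R := (law (size sa)%:R \x law (size sb)%:R).
have mpre s B : measurable B -> measurable (S s @^-1` B).
  by move=> mB; rewrite -[X in measurable X]setTI; exact: mS.
rewrite -[[set w | _]]setTI -[RHS]mul1e.
apply: (@joint_law_unique _ _ _ _ _ _ _ P (law (size sc)%:R) lab (S sc)
  (fun w => (S sa w, S sb w))) => //.
  exact: measurable_fun_pair.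
move=> C V mC mV.
apply: (joint_law_unique (m1 := law (size sa)%:R) (m2 := law (size sb)%:R) (mS sa) (mS sb)) => //.
  by rewrite setTI; exact: mpre.
move=> A B mA mB.
have mC' : measurable (setT `&` S sc @^-1` C) by rewrite setTI; exact: mpre.
have mCA : measurable (setT `&` S sc @^-1` C `&` S sa @^-1` A).
  by apply: measurableI => //; exact: mpre.
have h1 := chain_sum muE mX measurableT (chain_sample us) mC.
have h2 := chain_sum muE mX mC' h1 mA.
rewrite -[sb]cats0 in h2.
exact: (chain_sum muE mX mCA h2 mB).
Qed.

End sample.

(** * Weighted sums, ties, and the passage from positivity to signs *)

Lemma sum_uvec (R : realType) (D a c : nat) (Ia Ic : {set 'I_D}) (f : 'I_D -> R) :
  [disjoint Ia & Ic] ->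
  \sum_(i < D) uvec R Ia Ic a c i * f i =
  (a + c)%:R^-1 * (\sum_(i <- enum Ia) f i + \sum_(i <- enum Ic) f i).
Proof.
move=> dac; rewrite !big_enum/= -bigU//= mulr_sumr [RHS]big_mkcond/=.
apply: eq_bigr => i _; rewrite /uvec !inE.
by case: ifP => _; rewrite ?mul0r.
Qed.

Lemma uniq_enum_cat (T : finType) (A B : {set T}) :
  [disjoint A & B] -> uniq (enum A ++ enum B).
Proof.
move=> dAB; rewrite cat_uniq !enum_uniq andbT; apply/hasPn => i.
by rewrite !mem_enum => iB; rewrite (disjointFl dAB).
Qed.

(** Only a vanishing argument can make the comparison of signs differ from that of positivity; the
    second disjunct isolates this case. *)
Lemma sgr_neqE (R : realDomainType) (x y : R) :
  (Num.sg x != Num.sg y) =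
  ((0 < x) != (0 < y)) || (((x == 0) || (y == 0)) && ((x < 0) != (y < 0))).
Proof.
by case: (sgrP x); case: (sgrP y) => *; rewrite ?eqxx ?ltxx //=; lra.
Qed.

Theorem theorem2 (R : realType) (d : measure_display) (T : measurableType d)
  (P : probability T R) (D a b c : nat)
  (Ia Ib Ic : {set 'I_D}) (r : 'I_D -> {RV P >-> R}) :
  (1 <= a + c)%N -> (1 <= b + c)%N -> (a + b + c <= D)%N ->
  [disjoint Ia & Ib] -> [disjoint Ia & Ic] -> [disjoint Ib & Ic] ->
  #|Ia| = a -> #|Ib| = b -> #|Ic| = c ->
  mutually_independent r -> (forall i, standard_cauchy (r i)) ->
  let u := uvec R Ia Ic a c in
  let v := uvec R Ib Ic b c in
  let x := fun w => \sum_(i < D) u i * r i w in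
  let y := fun w => \sum_(i < D) v i * r i w in
  P [set w | Num.sg (x w) != Num.sg (y w)]%classic =
  ((1 / 2)%:E - (2 / pi ^+ 2)%:E *
     cauchy_expect (fun t : R => (atan_ratio c a `|t| * atan_ratio c b `|t|)%R))%E.
Proof.
move=> ac bc abcD dab dac dbc ca cb cc indep rC u v x y.
pose RT := measurableTypeR R.
(* The Cauchy law [mu] is realised below as the distribution of one sample variable, so an index is
   required; a + c >= 1 and a + b + c <= D provide it. *)
have [i0 _] : exists i0 : 'I_D, true.
  case: D abcD {Ia Ib Ic r dab dac dbc ca cb cc indep rC u v x y} => [|n] abcD.
    by have := leq_trans ac (leq_trans (leq_add (leq_addr b a) (leqnn c)) abcD).
  by exists ord0.
have mr i : measurable_fun setT (r i : T -> RT) by exact: (measurable_funP (r i)).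
pose r0 : {mfun T >-> RT} := HB.pack (r i0 : T -> RT) (isMeasurableFun.Build _ _ _ _ _ (mr i0)).
pose mu : probability RT R := distribution P r0.
have muE (A : set RT) : measurable A ->
    mu A = (\int[lebesgue_measure]_(x in A) (cauchy_pdf x)%:E)%E.
  exact: rC.
have rE i (A : set RT) : measurable A -> P (r i @^-1` A)%classic = mu A.
  by move=> mA; rewrite muE//; exact: rC.
pose sa := enum Ia; pose sb := enum Ib; pose sc := enum Ic.
have sza : size sa = a by rewrite -ca cardE.
have szb : size sb = b by rewrite -cb cardE.
have szc : size sc = c by rewrite -cc cardE.
have ucab : uniq (sc ++ sa ++ sb).
  rewrite catA cat_uniq uniq_enum_cat 1?disjoint_sym// enum_uniq andbT.
  apply/hasPn => i; rewrite mem_cat !mem_enum => ib.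
  by rewrite (disjointFl dab)// (disjointFr dbc).
pose S s (w : T) := \sum_(i <- s) r i w.
have xE w : x w = (a + c)%:R^-1 * (S sa w + S sc w) by exact: sum_uvec.
have yE w : y w = (b + c)%:R^-1 * (S sb w + S sc w) by exact: sum_uvec.
have null (s s' : seq 'I_D) : uniq (s ++ s') -> (0 < size s + size s')%N ->
    P [set w | (size s + size s')%:R^-1 * (S s w + S s' w) = 0]%classic = 0%E.
  move=> us s0; have := @sum_cauchy_eq0 _ _ _ P _ r mu muE rE indep _ us.
  rewrite size_cat => /(_ s0) <-; congr (P _); apply/seteqP; split => w /=.
    rewrite big_cat/= => /eqP; rewrite mulf_eq0 invr_eq0 pnatr_eq0 -leqn0 leqNgt s0/=.
    by move=> /eqP.
  by rewrite big_cat/= -/(S s w) -/(S s' w) => ->; rewrite mulr0.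
have Px0 : P [set w | x w = 0]%classic = 0%E.
  have := null sa sc (uniq_enum_cat dac); rewrite sza szc => /(_ ac) <-.
  by congr (P _); apply/seteqP; split => w /=; rewrite xE.
have Py0 : P [set w | y w = 0]%classic = 0%E.
  have := null sb sc (uniq_enum_cat dbc); rewrite szb szc => /(_ bc) <-.
  by congr (P _); apply/seteqP; split => w /=; rewrite yE.
have PW : P [set w | (0 < x w) != (0 < y w)]%classic =
  ((1 / 2)%:E - (2 / pi ^+ 2)%:E *
     cauchy_expect (fun t : R => (atan_ratio c a `|t| * atan_ratio c b `|t|)%R))%E.
  rewrite -(sign_disagreement_law muE)// -szc -sza -szb.
  rewrite -(three_sums_law muE rE)//; last exact: measurable_sign_disagreement.
  (* The normalising factors 1/(a + c) and 1/(b + c) are positive and leave positivity unchanged. *)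
  congr (P _); apply/seteqP; split => w /=.
    by rewrite xE yE !pmulr_rgt0// invr_gt0 ltr0n.
  by rewrite xE yE !pmulr_rgt0// invr_gt0 ltr0n.
have mS s : measurable_fun setT (S s : T -> R) by apply: measurable_sum.
have mx : measurable_fun setT x.
  by rewrite (funext xE); apply: measurable_funM => //; exact: measurable_funD.
have my : measurable_fun setT y.
  by rewrite (funext yE); apply: measurable_funM => //; exact: measurable_funD.
have meq0 (f : T -> R) : measurable_fun setT f -> measurable [set w | f w = 0]%classic.
  by move=> mf; have := mf measurableT [set 0]%classic (measurable_set1 0); rewrite setTI.
pose N : set T := ([set w | x w = 0] `|` [set w | y w = 0])%classic.
have mN : measurable N by apply: measurableU; exact: meq0.
pose Neg : set T := [set w | (x w < 0) != (y w < 0)]%classic.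
have mNeg : measurable Neg by apply: measurable_neqb; exact: measurable_fun_ltr.
(* The sign event is the positivity event enlarged by a subset of the null set [N]. *)
rewrite -PW (_ : [set w | Num.sg (x w) != _]%classic =
    ([set w | (0 < x w)%R != (0 < y w)%R] `|` (N `&` Neg))%classic); last first.
  apply/seteqP; split => w /=; rewrite sgr_neqE /N /Neg/=.
    move=> /orP[?|/andP[/orP[/eqP ?|/eqP ?] ?]]; [by left|right..]; split=> //.
      by left.
    by right.
  move=> [->//|[[->|->] ->]]; rewrite eqxx ?orbT//.
rewrite measureU0//.
- by apply: measurable_neqb; exact: measurable_fun_ltr.
- exact: measurableI.
- apply/eqP; rewrite -measure_le0; apply: (@le_trans _ _ (P N)).
    by apply: le_measure; rewrite ?inE//; exact: measurableI.
  apply: (le_trans (measureU2 P (meq0 _ mx) (meq0 _ my))).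
  by rewrite [X in (X + _)%E]Px0 [X in (_ + X)%E]Py0 adde0.
Qed.
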